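(* Let $\mathcal C$ be a small category and let $F$ be a form over $\mathcal C$ with finite indexed meets. (i) $F$ is isomorphic to the covering form of a unique Grothendieck topology if and only if $\sigma_F:F\to\mathscr S$ is fibrewise injective and its image is upward closed in each sieve fibre and satisfies locality: whenever $B$ lies in the image over $X$, $R$ is a sieve on $X$, and $f^*R$ lies in the image for every $f\in B$, the sieve $R$ lies in the image. (ii) $F$ is isomorphic to the saturation form of a unique Grothendieck topology if and only if $\sigma_F$ is fibrewise injective and its image is a reflective sub-indexed-poset of $\mathscr S$, with reflectors $j_X:\mathscr S_X\to\sigma_F(F_X)$ which preserve finite meets and commute with inverse images. In (i), the corresponding characterization for a distributivity form $F$ (isomorphism, as distributivity forms, with the covering form) is obtained by requiring in addition that the admissible final presentations are, under $\sigma_F$, exactly those maximal sieve presentations $U=\bigcup_if_iS_i$ whose sources $S_i$ and apex $U$ belong to the image. In (ii), it is obtained by requiring in addition that every structured sink is admissible and, identifying $F$ with its image under $\sigma_F$, its indexed join has the form $$\nabla_i(T_i,f_i)=j_X\Bigl(\bigcup_if_iT_i\Bigr).$$ These are strong distributivity-form characterizations whenever $\mathcal C$ has pullbacks.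
   Context: **Forms.** A form over $\mathcal C$ with finite indexed meets is a faithful amnestic functor $p:\mathcal E\to\mathcal C$ in which finite structured sources have initial lifts; equivalently a functor $F:\mathcal C^{\mathrm{op}}\to\mathbf{Meet}_\top$, where $\mathbf{Meet}_\top$ is the category of meet-semilattices with top and maps preserving finite meets (including top). Elements of $F_X$ are called clusters over $X$; $f^*:F_Y\to F_X$ is the action of $f:X\to Y$; $\top_X$ is the top of $F_X$. A structured sink over $X$ is a small family $(A_i,f_i)_{i}$ with $f_i:X_i\to X$ and $A_i\in F_{X_i}$. Its final lift (indexed join), if it exists, is the least $U\in F_X$ with $A_i\le f_i^*U$ for all $i$; one writes $U=\nabla_i(A_i,f_i)$, and the whole datum (sink and $U$) is a final presentation with sources $A_i$ and apex $U$. **Distributivity forms.** A distributivity form is a form $F$ with finite indexed meets together with a class of final presentations, called admissible, such that: (D1) every unit presentation $A=\nabla(A,1_X)$ is admissible, and admissibility is invariant under bijective reindexing; (D2) if $U=\nabla_i(A_i,f_i)$ and $A_i=\nabla_j(B_{ij},g_{ij})$ (all $i$) are admissible, so is $U=\nabla_{i,j}(B_{ij},f_ig_{ij})$; (D3) if $U=\nabla_i(A_i,f_i)$ is admissible and $C\in F_X$, then $U\wedge C=\nabla_i(A_i\wedge f_i^*C,f_i)$ is an admissible final presentation. It is strong if moreover: (D4) for every admissible $U=\nabla_i(A_i,f_i)$ over $X$ and $h:Y\to X$, with pullbacks $h_i:Y_i\to X_i$, $f_i':Y_i\to Y$ of $f_i$ and $h$, $h^*U=\nabla_i(h_i^*A_i,f_i')$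 is an admissible final presentation. **Sieves and support.** $\mathscr S_X$ is the poset of sieves on $X$ ordered by inclusion, with $f^*S=\{g\mid fg\in S\}$; $\nabla_i(S_i,f_i)=\bigcup_i f_iS_i$ with $fR=\{fg\mid g\in R\}$, and in the maximal distributivity all these presentations are admissible (''maximal sieve presentations''). For $A\in F_X$, $\sigma_F(A)=\{f:Y\to X\mid f^*A=\top_Y\}$; this defines a morphism of indexed meet-semilattices $\sigma_F:F\to\mathscr S$. **Forms of a topology $J$.** The covering form has fibres $J(X)\subseteq\mathscr S_X$, with admissible presentations those $U=\bigcup_if_iS_i$ with all $S_i$ and $U$ covering. With $j_J(S)=\{f:Y\to X\mid f^*S\in J(Y)\}$, the saturation form $\mathscr L_J$ has as clusters over $X$ the sieves $S$ with $j_J(S)=S$, all structured sinks being admissible with $\nabla_i(T_i,f_i)=j_J(\bigcup_if_iT_i)$. In both, order, meets and inverse images are those of $\mathscr S$. **Reflective.** The image being reflective with reflectors $j_X$ means that each inclusion $\sigma_F(F_X)\subseteq\mathscr S_X$ has left adjoint $j_X$; commuting with inverse images means $f^*j_Y(S)=j_X(f^*S)$ for $f:X\to Y$. *)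

(* Defs.v *)
From HB Require Import structures.
Set Warnings "-notation-overridden,-redundant-canonical-projection".
From mathcomp Require Import all_boot all_order.
From mathcomp Require Import boolp classical_sets.

Set Implicit Arguments.
Unset Strict Implicit.
Unset Printing Implicit Defensive.

Import Order.TTheory.

Local Open Scope order_scope.

Record category := Category {
  ob :> Type;
  hom : ob -> ob -> Type;
  idc : forall X, hom X X;
  comp : forall X Y Z, hom Y X -> hom Z Y -> hom Z X;
  comp1c : forall X Y (f : hom Y X), comp (idc X) f = f;
  compc1 : forall X Y (f : hom Y X), comp f (idc Y) = f;
  compA : forall X Y Z W (f : hom Y X) (g : hom Z Y) (h : hom W Z),
    comp f (comp g h) = comp (comp f g) h
}.

Arguments hom {_} _ _.
Arguments idc {_} _.

(* Composition is in the order of functions: [f \oc g] is "f after g". *)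
Notation "f \oc g" := (comp f g) (at level 40, left associativity).

Definition is_pullback (C : category) (X Y Z P : C) (f : hom X Z)
    (g : hom Y Z) (p : hom P X) (q : hom P Y) : Prop :=
  f \oc p = g \oc q /\
  forall (W : C) (u : hom W X) (v : hom W Y), f \oc u = g \oc v ->
    exists! w : hom W P, p \oc w = u /\ q \oc w = v.

Definition has_pullbacks (C : category) : Prop :=
  forall (X Y Z : C) (f : hom X Z) (g : hom Y Z),
  exists (P : C) (p : hom P X) (q : hom P Y), is_pullback f g p q.

(* A faithful amnestic functor into [C] in which finite structured sources have
   initial lifts is encoded by the equivalent functor from the opposite of [C]
   to meet-semilattices with top.  Classically, the boolean order and the
   choice operator carried by [tMeetSemilatticeType] are no restriction. *)
Record form (C : category) := Form {
  form_disp : Order.disp_t;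
  fibre : C -> tMeetSemilatticeType form_disp;
  pull : forall X Y, hom Y X -> fibre X -> fibre Y;
  pull_id : forall X (A : fibre X), pull (idc X) A = A;
  pull_comp : forall X Y Z (f : hom Y X) (g : hom Z Y) (A : fibre X),
    pull (f \oc g) A = pull g (pull f A);
  pullI : forall X Y (f : hom Y X) (A B : fibre X),
    pull f (A `&` B) = pull f A `&` pull f B;
  pullT : forall X Y (f : hom Y X), pull f \top = \top
}.

Coercion fibre : form >-> Funclass.
Arguments pull {C} {f} {X Y} _ _ : rename.

Record form_hom (C : category) (F G : form C) := FormHom {
  form_fun : forall X, F X -> G X;
  form_funI : forall X (A B : F X),
    form_fun (A `&` B) = form_fun A `&` form_fun B;
  form_funT : forall X, form_fun (\top : F X) = \top;
  form_fun_pull : forall X Y (f : hom Y X) (A : F X),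
    form_fun (pull f A) = pull f (form_fun A)
}.

Coercion form_fun : form_hom >-> Funclass.

Definition inverse_homs (C : category) (F G : form C)
    (phi : form_hom F G) (psi : form_hom G F) : Prop :=
  (forall X, cancel (phi X) (psi X)) /\ (forall X, cancel (psi X) (phi X)).

Definition form_iso (C : category) (F G : form C) : Prop :=
  exists (phi : form_hom F G) (psi : form_hom G F), inverse_homs phi psi.

Definition fibrewise_injective (C : category) (F G : form C)
    (phi : form_hom F G) : Prop :=
  forall X, injective (phi X).

Definition form_image (C : category) (F G : form C) (phi : form_hom F G)
    (X : C) : set (G X) :=
  range (phi X).

Lemma form_fun_le (C : category) (F G : form C) (phi : form_hom F G) X
  (A B : F X) : A <= B -> phi X A <= phi X B.
Proof.
move=> /meet_idPl AB; apply/meet_idPl.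
by rewrite -form_funI AB.
Qed.

Lemma pull_le (C : category) (F : form C) (X Y : C) (f : hom Y X)
  (A B : F X) : A <= B -> pull f A <= pull f B.
Proof.
move=> /meet_idPl AB; apply/meet_idPl.
by rewrite -pullI AB.
Qed.

(* "Small family" means that the index type lives in a fixed universe. *)
Record sink (C : category) (F : form C) (X : C) := Sink {
  sink_idx : Type;
  sink_dom : sink_idx -> C;
  sink_arr : forall i, hom (sink_dom i) X;
  sink_src : forall i, F (sink_dom i)
}.

Arguments Sink {C F X}.
Arguments sink_dom {C F X} s i : rename.
Arguments sink_arr {C F X} s i : rename.
Arguments sink_src {C F X} s i : rename.

Definition is_final (C : category) (F : form C) (X : C) (s : sink F X)
    (U : F X) : Prop :=
  (forall i, sink_src s i <= pull (sink_arr s i) U) /\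
  (forall V : F X, (forall i, sink_src s i <= pull (sink_arr s i) V) ->
     U <= V).

Definition unit_sink (C : category) (F : form C) (X : C) (A : F X) :
    sink F X :=
  Sink unit (fun=> X) (fun=> idc X) (fun=> A).

Definition reindex_sink (C : category) (F : form C) (X : C) (s : sink F X)
    (J : Type) (e : J -> sink_idx s) : sink F X :=
  Sink J (fun j => sink_dom s (e j)) (fun j => sink_arr s (e j))
    (fun j => sink_src s (e j)).

Definition comp_sink (C : category) (F : form C) (X : C) (s : sink F X)
    (t : forall i, sink F (sink_dom s i)) : sink F X :=
  Sink {i : sink_idx s & sink_idx (t i)}
    (fun k => sink_dom (t (projT1 k)) (projT2 k))
    (fun k => sink_arr s (projT1 k) \oc sink_arr (t (projT1 k)) (projT2 k))
    (fun k => sink_src (t (projT1 k)) (projT2 k)).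

Definition meet_sink (C : category) (F : form C) (X : C) (s : sink F X)
    (B : F X) : sink F X :=
  Sink (sink_idx s) (sink_dom s) (sink_arr s)
    (fun i => sink_src s i `&` pull (sink_arr s i) B).

Definition pull_sink (C : category) (F : form C) (X Y : C) (s : sink F X)
    (P : sink_idx s -> C) (p : forall i, hom (P i) (sink_dom s i))
    (q : forall i, hom (P i) Y) : sink F Y :=
  Sink (sink_idx s) P q (fun i => pull (p i) (sink_src s i)).

Definition map_sink (C : category) (F G : form C) (phi : form_hom F G)
    (X : C) (s : sink F X) : sink G X :=
  Sink (sink_idx s) (sink_dom s) (sink_arr s)
    (fun i => phi (sink_dom s i) (sink_src s i)).

Record distributivity_form (C : category) := DistributivityForm {
  dform :> form C;
  admissible : forall X : C, sink dform X -> dform X -> Prop;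
  admissible_final : forall X (s : sink dform X) (U : dform X),
    admissible s U -> is_final s U;
  admissible_unit : forall X (A : dform X), admissible (unit_sink A) A;
  admissible_reindex : forall X (s : sink dform X) (U : dform X) (J : Type)
      (e : J -> sink_idx s), bijective e ->
    (admissible (reindex_sink e) U <-> admissible s U);
  admissible_comp : forall X (s : sink dform X) (U : dform X)
      (t : forall i, sink dform (sink_dom s i)),
    admissible s U -> (forall i, admissible (t i) (sink_src s i)) ->
    admissible (comp_sink t) U;
  admissible_meet : forall X (s : sink dform X) (U B : dform X),
    admissible s U -> admissible (meet_sink s B) (U `&` B)
}.

Arguments admissible {C d X}.

(* The condition ranges over every choice of pullback squares [P], [p], [q]
   for the arrows of the sink; it is only meaningful when [C] has pullbacks. *)
Definition strong (C : category) (D : distributivity_form C) : Prop :=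
  forall (X Y : C) (h : hom Y X) (s : sink D X) (U : D X)
    (P : sink_idx s -> C) (p : forall i, hom (P i) (sink_dom s i))
    (q : forall i, hom (P i) Y),
  (forall i, is_pullback (sink_arr s i) h (p i) (q i)) ->
  admissible s U -> admissible (pull_sink p q) (pull h U).

Definition preserves_admissible (C : category) (D E : distributivity_form C)
    (phi : form_hom D E) : Prop :=
  forall (X : C) (s : sink D X) (U : D X),
  admissible s U -> admissible (map_sink phi s) (phi X U).

Definition distributivity_iso (C : category) (D E : distributivity_form C) :
    Prop :=
  exists (phi : form_hom D E) (psi : form_hom E D),
  [/\ inverse_homs phi psi, preserves_admissible phi
    & preserves_admissible psi].

Record sieve (C : category) (X : C) := Sieve {
  arrows :> forall Y : C, set (hom Y X);
  arrows_closed : forall (Y Z : C) (f : hom Y X) (g : hom Z Y),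
    arrows f -> arrows (f \oc g)
}.

Lemma sieveP (C : category) (X : C) (S T : sieve X) :
  (forall (Y : C) (f : hom Y X), S Y f <-> T Y f) -> S = T.
Proof.
case: S T => [S Sc] [T Tc] /= ST.
have {}ST : S = T by apply: functional_extensionality_dep => Y; apply/seteqP; split=> f; rewrite ST.
by rewrite -ST in Tc *; congr Sieve; apply: Prop_irrelevance.
Qed.

Fact sieve_display : Order.disp_t.
Proof. exact: Order.Disp tt tt. Qed.

Section SievePoset.
Variables (C : category) (X : C).
Implicit Types S T : sieve X.

Definition sieve_sub S T : Prop := forall Y : C, (S Y `<=` T Y)%classic.

Lemma sieve_sub_refl : reflexive (fun S T => `[< sieve_sub S T >]).
Proof. by move=> S; apply/asboolP => Y f. Qed.

Lemma sieve_sub_anti : antisymmetric (fun S T => `[< sieve_sub S T >]).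
Proof.
move=> S T /andP[/asboolP ST /asboolP TS]; apply: sieveP => Y f.
by split=> [/ST|/TS].
Qed.

Lemma sieve_sub_trans : transitive (fun S T => `[< sieve_sub S T >]).
Proof.
move=> S T U /asboolP TS /asboolP SU; apply/asboolP => Y f /TS.
exact: SU.
Qed.

Definition sieve_meet S T : sieve X.
Proof.
exists (fun Y => S Y `&` T Y)%classic => Y Z f g [Sf Tf].
by split; apply: arrows_closed.
Defined.

Definition sieve_top : sieve X.
Proof. by exists (fun Y => setT). Defined.

HB.instance Definition _ := Choice.copy (sieve X) {classic (sieve X)}.
HB.instance Definition _ :=
  Order.Le_isPOrder.Build sieve_display (sieve X)
    sieve_sub_refl sieve_sub_anti sieve_sub_trans.

Lemma sieve_leP S T : reflect (sieve_sub S T) (S <= T).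
Proof. exact: asboolP. Qed.

Lemma sieve_lexI S T U : (S <= sieve_meet T U) = (S <= T) && (S <= U).
Proof.
apply/sieve_leP/andP => [STU|[/sieve_leP ST /sieve_leP SU]].
  by split; apply/sieve_leP => Y f /STU [].
by move=> Y f Sf; split; [apply: ST|apply: SU].
Qed.

Lemma sieve_lex1 S : S <= sieve_top.
Proof. by apply/sieve_leP. Qed.

HB.instance Definition _ :=
  Order.POrder_isMeetSemilattice.Build sieve_display (sieve X)
    sieve_lexI.
HB.instance Definition _ :=
  Order.hasTop.Build sieve_display (sieve X) sieve_lex1.

End SievePoset.

Definition pull_sieve (C : category) (X Y : C) (f : hom Y X) (S : sieve X) :
  sieve Y.
Proof.
exists (fun Z g => S Z (f \oc g)) => Z W g h Sfg.
by rewrite compA; apply: arrows_closed.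
Defined.

Lemma pull_sieve_id (C : category) (X : C) (S : sieve X) :
  pull_sieve (idc X) S = S.
Proof. by apply: sieveP => Y f /=; rewrite comp1c. Qed.

Lemma pull_sieve_comp (C : category) (X Y Z : C) (f : hom Y X)
  (g : hom Z Y) (S : sieve X) :
  pull_sieve (f \oc g) S = pull_sieve g (pull_sieve f S).
Proof. by apply: sieveP => W h /=; rewrite compA. Qed.

Lemma pull_sieveI (C : category) (X Y : C) (f : hom Y X) (S T : sieve X) :
  pull_sieve f (S `&` T) = pull_sieve f S `&` pull_sieve f T.
Proof. exact: sieveP. Qed.

Lemma pull_sieveT (C : category) (X Y : C) (f : hom Y X) :
  pull_sieve f \top = \top.
Proof. exact: sieveP. Qed.

Lemma pull_sieve_top (C : category) (X Y : C) (f : hom Y X) (S : sieve X) :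
  S Y f -> pull_sieve f S = \top.
Proof. by move=> Sf; apply: sieveP => Z g; split=> // _; apply: arrows_closed. Qed.

Lemma pull_sieve_topE (C : category) (X Y : C) (f : hom Y X) (S : sieve X) :
  pull_sieve f S = \top -> S Y f.
Proof.
move=> Sf; rewrite -[f]compc1.
by have : (pull_sieve f S) Y (idc Y) by rewrite Sf.
Qed.

Definition sieve_form (C : category) : form C :=
  @Form C _ (fun X => sieve X : tMeetSemilatticeType _) (@pull_sieve C)
    (@pull_sieve_id C) (@pull_sieve_comp C) (@pull_sieveI C)
    (@pull_sieveT C).

Definition sink_union (C : category) (X : C) (s : sink (sieve_form C) X) :
  sieve X.
Proof.
exists (fun Z => [set k | exists (i : sink_idx s) (g : hom Z (sink_dom s i)),
          (sink_src s i : sieve _) Z g /\ k = sink_arr s i \oc g]%classic).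
move=> Y Z f h [i [g [sg ->]]]; exists i, (g \oc h); rewrite compA.
by split=> //; apply: arrows_closed.
Defined.

Section SieveDistributivity.
Variable C : category.
Local Notation S := (sieve_form C).

Lemma sink_union_le (X : C) (s : sink S X) (U : sieve X) :
  sink_union s <= U <->
  forall i, (sink_src s i : sieve _) <= pull_sieve (sink_arr s i) U.
Proof.
split=> [/sieve_leP sU i|sU].
  by apply/sieve_leP => Z g sg; apply: sU; exists i, g.
apply/sieve_leP => Z k [i [g [sg ->]]].
by have /sieve_leP := sU i; apply.
Qed.

Definition maximal_presentation (X : C) (s : sink S X) (U : S X) : Prop :=
  (U : sieve X) = sink_union s.

Lemma maximal_final (X : C) (s : sink S X) (U : S X) :
  maximal_presentation s U -> is_final s U.
Proof.
move=> ->; split=> [|V sV]; first exact: (proj1 (sink_union_le s _)).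
exact: (proj2 (sink_union_le s V)).
Qed.

Lemma sink_union_unit (X : C) (A : S X) : sink_union (unit_sink A) = A.
Proof.
apply: sieveP => Y f; split=> [[i [g [Ag ->]]]|Af].
  by rewrite /= comp1c.
by exists tt, f; rewrite comp1c.
Qed.

Lemma sink_union_reindex (X : C) (s : sink S X) (J : Type)
  (e : J -> sink_idx s) : bijective e ->
  sink_union (reindex_sink e) = sink_union s.
Proof.
case=> e' eK e'K; apply: sieveP => Y f; split=> -[i [g [sg ->]]].
  by exists (e i), g.
by rewrite -(e'K i) in g sg *; exists (e' i), g.
Qed.

Lemma sink_union_comp (X : C) (s : sink S X)
  (t : forall i, sink S (sink_dom s i)) :
  sink_union (comp_sink t) =
  sink_union (Sink (sink_idx s) (sink_dom s) (sink_arr s)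
                (fun i => sink_union (t i) : S _)).
Proof.
apply: sieveP => Y f; split.
  case=> -[i j] [g [tg ->]].
  exists i, (sink_arr (t i) j \oc g); split; last by rewrite compA.
  by exists j, g.
case=> i [_ [[j [g [tg ->]]] ->]].
by exists (existT _ i j), g; rewrite compA.
Qed.

Lemma sink_union_meet (X : C) (s : sink S X) (B : S X) :
  sink_union (meet_sink s B) = sink_union s `&` (B : sieve X).
Proof.
apply: sieveP => Y f; split.
  by case=> i [g [[sg Bg] ->]]; split=> //; exists i, g.
by case=> -[i [g [sg ->]]] Bg; exists i, g.
Qed.

Definition sieve_distributivity : distributivity_form C.
Proof.
apply: (@DistributivityForm C S maximal_presentation maximal_final).
- by move=> X A; rewrite /maximal_presentation sink_union_unit.
- by move=> X s U J e bij_e; rewrite /maximal_presentation sink_union_reindex.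
- move=> X s U t sU tA; rewrite /maximal_presentation sink_union_comp sU.
  congr (sink_union _); case: s t tA {sU} => I d a A t tA /=; congr Sink.
  by apply: functional_extensionality_dep => i; apply: tA.
- by move=> X s U B sU; rewrite /maximal_presentation sink_union_meet sU.
Defined.

End SieveDistributivity.

Section Support.
Variables (C : category) (F : form C).

Definition support_sieve (X : C) (A : F X) : sieve X.
Proof.
exists (fun Y => [set f | pull f A = \top]%classic) => Y Z f g /= fA.
by rewrite pull_comp fA pullT.
Defined.

Lemma support_sieveI (X : C) (A B : F X) :
  support_sieve (A `&` B) = support_sieve A `&` support_sieve B.
Proof.
apply: sieveP => Y f; split=> /=; last first.
  by case=> /= fA fB; rewrite pullI fA fB meetxx.
rewrite pullI => fAB; split=> /=; apply/eqP; rewrite -le1x -fAB.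
  exact: leIl.
exact: leIr.
Qed.

Lemma support_sieveT (X : C) : support_sieve (\top : F X) = \top.
Proof. by apply: sieveP => Y f; split=> //= _; exact: pullT. Qed.

Lemma support_sieve_pull (X Y : C) (f : hom Y X) (A : F X) :
  support_sieve (pull f A) = pull_sieve f (support_sieve A).
Proof. by apply: sieveP => Z g /=; rewrite pull_comp. Qed.

Definition support : form_hom F (sieve_form C) :=
  @FormHom C F (sieve_form C) support_sieve
    support_sieveI support_sieveT support_sieve_pull.

End Support.

Record subform_closed (C : category) (P : forall X : C, set (sieve X)) :
    Prop := SubformClosed {
  closedT : forall X : C, P X \top;
  closedI : forall (X : C) (S T : sieve X), P X S -> P X T -> P X (S `&` T);
  closed_pull : forall (X Y : C) (f : hom Y X) (S : sieve X),
    P X S -> P Y (pull_sieve f S)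
}.

Section Subform.
Variables (C : category) (P : forall X : C, set (sieve X)).

Record subsieve (X : C) := Subsieve {
  subsieve_val :> sieve X;
  subsieveP : P subsieve_val
}.

Lemma subsieve_inj (X : C) : injective (@subsieve_val X).
Proof.
move=> [S PS] [T PT] /= ST; rewrite -ST in PT *.
by congr Subsieve; apply: Prop_irrelevance.
Qed.

HB.instance Definition _ (X : C) :=
  Choice.copy (subsieve X) {classic (subsieve X)}.

Section Poset.
Variable X : C.
Implicit Types S T : subsieve X.

Definition subsieve_le S T := subsieve_val S <= subsieve_val T.

Lemma subsieve_le_refl : reflexive subsieve_le.
Proof. by move=> S; apply: lexx. Qed.

Lemma subsieve_le_anti : antisymmetric subsieve_le.
Proof. by move=> S T ST; apply: subsieve_inj; apply: le_anti. Qed.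

Lemma subsieve_le_trans : transitive subsieve_le.
Proof. by move=> T S U; apply: le_trans. Qed.

HB.instance Definition _ :=
  Order.Le_isPOrder.Build sieve_display (subsieve X)
    subsieve_le_refl subsieve_le_anti subsieve_le_trans.
End Poset.

Hypothesis P_closed : subform_closed P.

Section Fibre.
Variable X : C.
Let disp := sieve_display.
Implicit Types S T : subsieve X.

Definition subsieve_meet S T : subsieve X :=
  Subsieve (closedI P_closed (subsieveP S) (subsieveP T)).

Definition subsieve_top : subsieve X := Subsieve (closedT P_closed X).

Lemma subsieve_lexI S T U :
  (S <= subsieve_meet T U) = (S <= T) && (S <= U).
Proof. exact: (@lexI _ (sieve X : tMeetSemilatticeType _)). Qed.

Lemma subsieve_lex1 S : S <= subsieve_top.
Proof. exact: (@lex1 _ (sieve X : tMeetSemilatticeType _)). Qed.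

Definition subform_fibre : tMeetSemilatticeType disp :=
  HB.pack (subsieve X)
    (Order.POrder_isMeetSemilattice.Build disp (subsieve X) subsieve_lexI)
    (Order.hasTop.Build disp (subsieve X) subsieve_lex1).

End Fibre.

Definition subform_pull (X Y : C) (f : hom Y X) (S : subform_fibre X) :
    subform_fibre Y :=
  Subsieve (closed_pull P_closed f (subsieveP S)).

Definition subform : form C.
Proof.
apply: (@Form C _ subform_fibre subform_pull).
- by move=> X A; apply: subsieve_inj; apply: pull_sieve_id.
- by move=> *; apply: subsieve_inj; apply: pull_sieve_comp.
- by move=> *; apply: subsieve_inj; apply: pull_sieveI.
- by move=> *; apply: subsieve_inj; apply: pull_sieveT.
Defined.

Definition subform_incl : form_hom subform (sieve_form C).
Proof. by exists (fun X (S : subform X) => subsieve_val S). Defined.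

Lemma subform_leE (X : C) (S T : subform X) :
  (S <= T) = (subform_incl X S <= subform_incl X T).
Proof. by []. Qed.

End Subform.

Record topology (C : category) := Topology {
  covers : forall X : C, set (sieve X);
  covers_top : forall X : C, covers (\top : sieve X);
  covers_pull : forall (X Y : C) (f : hom Y X) (S : sieve X),
    covers S -> covers (pull_sieve f S);
  covers_local : forall (X : C) (B R : sieve X), covers B ->
    (forall (Y : C) (f : hom Y X), B Y f -> covers (pull_sieve f R)) ->
    covers R
}.

Section FormsOfTopology.
Variables (C : category) (J : topology C).

Lemma covers_up (X : C) (S T : sieve X) :
  S <= T -> covers J S -> covers J T.
Proof.
move=> /sieve_leP ST JS; apply: covers_local JS _ => Y f Sf.
by rewrite pull_sieve_top; [apply: covers_top|apply: ST].
Qed.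

Lemma coversI (X : C) (S T : sieve X) :
  covers J S -> covers J T -> covers J (S `&` T).
Proof.
move=> JS JT; apply: covers_local JS _ => Y f Sf.
by rewrite pull_sieveI (pull_sieve_top Sf) meet1x; apply: covers_pull.
Qed.

Lemma covers_closed : subform_closed (covers J).
Proof.
by split=> [X|X S T|X Y f S]; [apply: covers_top|apply: coversI|
  apply: covers_pull].
Qed.

Definition covering_form : form C := subform covers_closed.

Definition covering_distributivity : distributivity_form C.
Proof.
apply: (@DistributivityForm C covering_form (fun X s U =>
  maximal_presentation (map_sink (subform_incl covers_closed) s)
    (subform_incl covers_closed X U))).
- move=> X s U /maximal_final[sU Umin].
  by split=> [i|V sV]; [apply: sU|apply: Umin].
- move=> X A.
  exact: (@admissible_unit _ (sieve_distributivity C)).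
- move=> X s U I e bij_e.
  exact: (@admissible_reindex _ (sieve_distributivity C) _
    (map_sink (subform_incl covers_closed) s) _ _ _ bij_e).
- move=> X s U t sU tA.
  exact: (@admissible_comp _ (sieve_distributivity C) _
    (map_sink (subform_incl covers_closed) s) _
    (fun i => map_sink (subform_incl covers_closed) (t i)) sU tA).
- move=> X s U B sU.
  exact: (@admissible_meet _ (sieve_distributivity C) _
    (map_sink (subform_incl covers_closed) s) _
    (subform_incl covers_closed X B) sU).
Defined.

(* The operator j_J of the topology [J]. *)
Definition closure (X : C) (S : sieve X) : sieve X.
Proof.
exists (fun Y => [set f | covers J (pull_sieve f S)]%classic) => Y Z f g /= Sf.
by rewrite pull_sieve_comp; apply: covers_pull.
Defined.

Lemma closure_pull (X Y : C) (f : hom Y X) (S : sieve X) :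
  closure (pull_sieve f S) = pull_sieve f (closure S).
Proof. by apply: sieveP => Z g /=; rewrite pull_sieve_comp. Qed.

Lemma closureI (X : C) (S T : sieve X) :
  closure (S `&` T) = closure S `&` closure T.
Proof.
apply: sieveP => Y f /=; rewrite pull_sieveI; split; last first.
  by case=> /= Sf Tf; apply: coversI.
by move=> STf; split; apply: covers_up STf; rewrite (leIl, leIr).
Qed.

Lemma closure_ge (X : C) (S : sieve X) : S <= closure S.
Proof.
apply/sieve_leP => Y f Sf /=.
by rewrite pull_sieve_top //; apply: covers_top.
Qed.

Lemma closure_le (X : C) (S T : sieve X) : S <= T -> closure S <= closure T.
Proof. by move=> /meet_idPl ST; apply/meet_idPl; rewrite -closureI ST. Qed.

Lemma closureK (X : C) (S : sieve X) : closure (closure S) = closure S.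
Proof.
apply/eqP; rewrite eq_le closure_ge andbT; apply/sieve_leP => Y f /= SSf.
apply: covers_local SSf _ => Z g /=.
by rewrite pull_sieve_comp.
Qed.

Definition saturated (X : C) : set (sieve X) :=
  [set S | closure S = S]%classic.

Lemma saturated_closed : subform_closed saturated.
Proof.
split=> [X|X S T|X Y f S]; rewrite /saturated /=.
- by apply/eqP; rewrite -le1x; apply: closure_ge.
- by move=> cS cT; rewrite closureI cS cT.
- by move=> cS; rewrite closure_pull cS.
Qed.

Definition saturation_form : form C := subform saturated_closed.

Local Notation incl := (subform_incl saturated_closed).

Definition saturated_presentation (X : C) (s : sink saturation_form X)
    (U : saturation_form X) : Prop :=
  subsieve_val U = closure (sink_union (map_sink incl s)).

Lemma closure_union_le (X : C) (s : sink (sieve_form C) X)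
  (U : saturation_form X) :
  (closure (sink_union s) <= subsieve_val U) =
  (sink_union s <= subsieve_val U).
Proof.
apply/idP/idP; first exact: le_trans (closure_ge _).
by move=> /closure_le; rewrite (subsieveP U).
Qed.

Definition saturation_distributivity : distributivity_form C.
Proof.
apply: (@DistributivityForm C saturation_form saturated_presentation).
- move=> X s U sU; split=> [|V sV].
    suff /sink_union_le : sink_union (map_sink incl s) <= subsieve_val U by [].
    by rewrite sU closure_ge.
  rewrite subform_leE /= sU closure_union_le.
  exact/sink_union_le.
- move=> X A; rewrite /saturated_presentation.
  rewrite -[RHS]/(closure (sink_union (unit_sink (incl X A)))).
  by rewrite sink_union_unit /= (subsieveP A).
- move=> X s U I e bij_e; rewrite /saturated_presentation.
  by rewrite -(sink_union_reindex (s := map_sink incl s) bij_e).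
- move=> X s U t sU tA.
  set st := fun i => map_sink incl (t i).
  suff cst : closure (sink_union (map_sink incl s)) =
             closure (sink_union (@comp_sink _ _ _ (map_sink incl s) st)).
    by rewrite /saturated_presentation sU cst.
  rewrite sink_union_comp; apply/eqP; rewrite eq_le; apply/andP; split.
    rewrite -[X in _ <= X]closureK; apply: closure_le.
    apply/sink_union_le => i; rewrite /= (tA i) -closure_pull.
    apply: closure_le; apply/sieve_leP => Y g tg.
    by exists i, g.
  apply: closure_le; apply/sink_union_le => i /=.
  apply: le_trans (closure_ge _) _; rewrite -(tA i).
  by apply/sieve_leP => Y g sg; exists i, g.
- move=> X s U B sU; rewrite /saturated_presentation.
  rewrite -[map_sink _ _]/(meet_sink (map_sink incl s) (incl X B)).
  by rewrite sink_union_meet closureI -sU /= (subsieveP B).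
Defined.

End FormsOfTopology.

Definition upward_closed (C : category) (P : forall X : C, set (sieve X)) :
    Prop :=
  forall (X : C) (S T : sieve X), P X S -> S <= T -> P X T.

Definition locality (C : category) (P : forall X : C, set (sieve X)) : Prop :=
  forall (X : C) (B R : sieve X), P X B ->
    (forall (Y : C) (f : hom Y X), B Y f -> P Y (pull_sieve f R)) ->
    P X R.

Definition sub_indexed_poset (C : category)
    (P : forall X : C, set (sieve X)) : Prop :=
  forall (X Y : C) (f : hom Y X) (S : sieve X), P X S -> P Y (pull_sieve f S).

(* The reflectors are typed as maps into all sieves and land in [P] by
   [reflector_in].  [P] will be the image of [support], whose finite meets are
   those of sieves because [support] preserves them. *)
Record lex_reflectors (C : category) (P : forall X : C, set (sieve X))
    (j : forall X : C, sieve X -> sieve X) : Prop := LexReflectors {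
  reflector_in : forall (X : C) (S : sieve X), P X (j X S);
  reflector_adj : forall (X : C) (S T : sieve X), P X T ->
    (j X S <= T) = (S <= T);
  reflectorI : forall (X : C) (S T : sieve X),
    j X (S `&` T) = j X S `&` j X T;
  reflectorT : forall X : C, j X \top = \top;
  reflector_pull : forall (X Y : C) (f : hom X Y) (S : sieve Y),
    pull_sieve f (j Y S) = j X (pull_sieve f S)
}.

Definition support_image (C : category) (F : form C) (X : C) :
    set (sieve X) :=
  form_image (support F) (X := X).

Definition covering_condition (C : category) (F : form C) : Prop :=
  [/\ fibrewise_injective (support F), upward_closed (support_image F)
    & locality (support_image F)].

Definition saturation_condition (C : category) (F : form C) : Prop :=
  [/\ fibrewise_injective (support F), sub_indexed_poset (support_image F)
    & exists j : forall X : C, sieve X -> sieve X,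
        lex_reflectors (support_image F) j].

(* The presentations [(t, V)] range over all presentations in sieves; the
   condition equates the images under the support of the admissible ones with
   the maximal ones whose sources and apex lie in the image. *)
Definition admissible_are_maximal (C : category) (D : distributivity_form C) :
    Prop :=
  forall (X : C) (t : sink (sieve_form C) X) (V : sieve_form C X),
  (exists (s : sink D X) (U : D X),
     [/\ admissible s U, map_sink (support D) s = t & support D X U = V])
  <->
  [/\ @admissible C (sieve_distributivity C) X t V,
      forall i, support_image D (sink_src t i) & support_image D V].

Definition covering_distributivity_condition (C : category)
    (D : distributivity_form C) : Prop :=
  covering_condition D /\ admissible_are_maximal D.

Definition saturation_distributivity_condition (C : category)
    (D : distributivity_form C) : Prop :=
  [/\ fibrewise_injective (support D), sub_indexed_poset (support_image D)
    & exists2 j : forall X : C, sieve X -> sieve X,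
        lex_reflectors (support_image D) j
      & forall (X : C) (s : sink D X), exists2 U : D X,
          admissible s U
        & support D X U = j X (sink_union (map_sink (support D) s))].

(* Main.v *)
Require Import Defs.
From mathcomp Require Import ssreflect ssrbool.
From mathcomp Require Import ssrfun eqtype order boolp classical_sets.

(** Everything follows from one remark: the support is natural under
    isomorphism, [support G (phi A) = support F A], because an isomorphism
    preserves and reflects the equation [pull f A = \top]; and on a form of
    sieves the support is the inclusion, because [f^*S] is the top sieve exactly
    when [f] belongs to [S] ([support_subform]).  A form isomorphic to a form
    of sieves [P] is therefore recovered from its support: this is injective
    with image [P], and conversely, when it is injective with image [P], its
    corestriction is the isomorphism ([form_iso_subformP]).  For the same
    reason, if admissibility in [E] can be read off from supports, then an
    isomorphism from [D] to [E] is an isomorphism of the underlying forms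
    together with the same reading of admissibility in [D]
    ([distributivity_isoP]).

    What is left is to say which families of sieves occur, and that they
    determine the topology.

    - The families [covers J] are the families that contain the top sieves and
      are closed under inverse images, upward closed and local; an image of a
      support always has the first two properties.

    - The families [saturated J] are those with lex reflectors.  For such a
      family with reflectors [j], the sieves with [j S = \top] form a topology
      whose closure operator is [j], since [f^*(j S) = j (f^*S)] is the top
      sieve exactly when [f] belongs to [j S] ([closure_lex_topology]).
      Conversely [J] is recovered from [saturated J]: a sieve covers exactly
      when the top sieve is the only saturated sieve above it
      ([covers_saturated]).

    For distributivity forms, final lifts are unique, so a prescribed final
    lift for every sink determines all admissible presentations.  Strength is
    the pullback property in elementary form: an arrow [k] with [h k] in
    [f_i S_i] factors through the projection [f_i'] of the pullback
    ([sink_union_pull]).  It is transported along isomorphisms, and closure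
    operators commute with inverse images. *)

Set Implicit Arguments.
Unset Strict Implicit.
Unset Printing Implicit Defensive.

Import Order.TTheory.
Local Open Scope order_scope.

(** * Isomorphisms of forms and supports *)

Section Isomorphisms.
Variable C : category.
Implicit Types F G : form C.

(** Preserving finite meets includes preserving [\top], so injectivity
    makes [phi] reflect the equations that define the support. *)
Lemma support_natural F G (phi : form_hom F G)
  (phi_inj : fibrewise_injective phi) (X : C) (A : F X) :
  support G X (phi X A) = support F X A.
Proof.
apply: sieveP => Y f /=; rewrite -form_fun_pull -(form_funT phi).
by split=> [/phi_inj| ->].
Qed.

Lemma inverse_homs_sym F G (phi : form_hom F G) (psi : form_hom G F) :
  inverse_homs phi psi -> inverse_homs psi phi.
Proof. by case. Qed.

Lemma inverse_homs_inj F G (phi : form_hom F G) (psi : form_hom G F) :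
  inverse_homs phi psi -> fibrewise_injective phi.
Proof. by case=> phiK _ X; apply: can_inj (phiK X). Qed.

(** Morphisms of forms are algebraic (they preserve operations), so that a
    fibrewise inverse is again a morphism. *)
Lemma bijective_form_hom F G (phi : form_hom F G) :
  fibrewise_injective phi -> (forall X (B : G X), exists A, phi X A = B) ->
  exists psi, inverse_homs phi psi.
Proof.
move=> phi_inj phi_surj.
pose psi X B := sval (cid (phi_surj X B)).
have psiK X (B : G X) : phi X (psi X B) = B := svalP (cid (phi_surj X B)).
have phiK X (A : F X) : psi X (phi X A) = A by apply: phi_inj; apply: psiK.
have psiI X (A B : G X) : psi X (A `&` B) = psi X A `&` psi X B.
  by apply: phi_inj; rewrite form_funI !psiK.
have psiT X : psi X \top = \top by apply: phi_inj; rewrite form_funT psiK.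
have psi_pull X Y (f : hom Y X) (B : G X) : psi Y (pull f B) = pull f (psi X B).
  by apply: phi_inj; rewrite form_fun_pull !psiK.
by exists (FormHom psiI psiT psi_pull).
Qed.

Lemma pull_sieve_topP (X Y : C) (f : hom Y X) (S : sieve X) :
  pull_sieve f S = \top <-> S Y f.
Proof. by split=> [/pull_sieve_topE|/pull_sieve_top]. Qed.

Section FormsOfSieves.
Variables (P : forall X : C, set (sieve X)) (P_closed : subform_closed P).
Let incl := subform_incl P_closed.

(** Membership of [f] in [S] is expressed inside the form, by [f^*S] being top;
    so a form of sieves, even up to isomorphism, remembers its sieves. *)
Lemma support_subform (X : C) (S : subform P_closed X) :
  support (subform P_closed) X S = incl X S.
Proof.
apply: sieveP => Y f; split=> [/(congr1 (@subsieve_val _ _ _))|Sf].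
  by move/pull_sieve_topP.
by apply: subsieve_inj; apply/pull_sieve_topP.
Qed.

(** By naturality, an isomorphism to a form of sieves followed by the inclusion
    is the support, so the corestricted support is the only candidate. *)
Lemma form_iso_subformP F :
  form_iso F (subform P_closed) <->
  fibrewise_injective (support F) /\
  (forall X (S : sieve X), support_image F S <-> P S).
Proof.
split=> [[phi [psi pp]]|[F_inj F_im]].
  have phi_inj := inverse_homs_inj pp; case: (pp) => _ psiK.
  have FE X (A : F X) : support F X A = subsieve_val (phi X A).
    by rewrite -(support_natural phi_inj) support_subform.
  split=> [X A B|X S].
    by rewrite !FE => /subsieve_inj/phi_inj.
  split=> [[A _ <-]|PS]; first by rewrite FE; apply: subsieveP.
  by exists (psi X (Subsieve PS)) => //; rewrite FE psiK.
have P_support X (A : F X) : P (support F X A) by apply/F_im; exists A.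
pose phi X (A : F X) : subform P_closed X := Subsieve (P_support X A).
have phiI X (A B : F X) : phi X (A `&` B) = phi X A `&` phi X B.
  by apply: subsieve_inj; apply: support_sieveI.
have phiT X : phi X \top = \top.
  by apply: subsieve_inj; apply: support_sieveT.
have phi_pull X Y (f : hom Y X) (A : F X) : phi Y (pull f A) = pull f (phi X A).
  by apply: subsieve_inj; apply: support_sieve_pull.
have [X A B /(congr1 (@subsieve_val _ _ _))/F_inj //|X [S PS]|psi pp] :=
  @bijective_form_hom _ _ (FormHom phiI phiT phi_pull).
  by have /F_im[A _ AS] := PS; exists A; apply: subsieve_inj.
by exists (FormHom phiI phiT phi_pull), psi.
Qed.

End FormsOfSieves.

Lemma support_image_pull F : sub_indexed_poset (support_image F).
Proof.
move=> X Y f _ [A _ <-]; exists (pull f A) => //.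
exact: support_sieve_pull.
Qed.

Lemma support_imageT F (X : C) : support_image F (\top : sieve X).
Proof. by exists \top => //; apply: support_sieveT. Qed.

End Isomorphisms.

(** * Isomorphisms of distributivity forms *)

Section DistributivityIsomorphisms.
Variable C : category.

Lemma map_sink_comp (F G H : form C) (phi : form_hom F G) (psi : form_hom G H)
  (chi : form_hom F H) (chiE : forall X A, psi X (phi X A) = chi X A)
  (X : C) (s : sink F X) : map_sink psi (map_sink phi s) = map_sink chi s.
Proof.
by congr Sink; apply: functional_extensionality_dep => i; apply: chiE.
Qed.

Lemma map_sinkK (F G : form C) (phi : form_hom F G) (psi : form_hom G F) :
  inverse_homs phi psi -> forall X,
  cancel (map_sink phi (X := X)) (map_sink psi (X := X)).
Proof.
case=> phiK _ X [I d a A]; congr Sink.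
by apply: functional_extensionality_dep => i; apply: phiK.
Qed.

Lemma is_final_uniq (F : form C) (X : C) (s : sink F X) (U V : F X) :
  is_final s U -> is_final s V -> U = V.
Proof.
by case=> sU Umin [sV Vmin]; apply: le_anti; rewrite Umin ?Vmin.
Qed.

(** The hypothesis says that admissibility in [E] is visible on supports; then
    it can be compared across an isomorphism, which does not change supports. *)
Lemma distributivity_isoP (D E : distributivity_form C)
    (Q : forall X, sink (sieve_form C) X -> sieve X -> Prop)
    (EQ : forall X (s : sink E X) (U : E X),
      admissible s U <-> Q X (map_sink (support E) s) (support E X U)) :
  distributivity_iso D E <->
  form_iso D E /\
  (forall X (s : sink D X) (U : D X),
     admissible s U <-> Q X (map_sink (support D) s) (support D X U)).
Proof.
have transport (phi : form_hom D E) (psi : form_hom E D) :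
    inverse_homs phi psi -> forall X (s : sink D X) (U : D X),
    admissible (map_sink phi s) (phi X U) <->
    Q X (map_sink (support D) s) (support D X U).
  move=> /inverse_homs_inj phi_inj X s U; rewrite EQ.
  by rewrite (map_sink_comp (support_natural phi_inj)) support_natural.
split=> [[phi [psi [pp phiA psiA]]]|[[phi [psi pp]] DQ]].
  split=> [|X s U]; first by exists phi, psi.
  rewrite -(transport _ _ pp); split=> [/phiA //|/psiA].
  by rewrite (map_sinkK pp) (proj1 pp).
exists phi, psi; split=> // X s U.
  by rewrite (transport _ _ pp) DQ.
rewrite -{1}(map_sinkK (inverse_homs_sym pp) s) -{1}(proj2 pp _ U).
by rewrite (transport _ _ pp) -DQ.
Qed.

(** Morphisms of forms commute with inverse images, hence with the formation of
    pulled back sinks. *)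
Lemma distributivity_iso_strong (D E : distributivity_form C) :
  distributivity_iso D E -> strong E -> strong D.
Proof.
move=> [phi [psi [pp phiA psiA]]] E_strong X Y h s U P p q pb /phiA sU.
have := psiA _ _ _ (E_strong _ _ _ (map_sink phi s) _ _ p q pb sU).
rewrite -form_fun_pull (proj1 pp).
suff -> : map_sink psi (pull_sink (s := map_sink phi s) p q) = pull_sink p q.
  by [].
congr Sink; apply: functional_extensionality_dep => i /=.
by rewrite -form_fun_pull (proj1 pp).
Qed.

End DistributivityIsomorphisms.

(** * Topologies from their covering or saturated sieves *)

Section Topologies.
Variable C : category.
Implicit Types J : topology C.

Lemma topologyP J J' :
  (forall X (S : sieve X), covers J S <-> covers J' S) -> J = J'.
Proof.
case: J J' => c cT cp cl [c' c'T c'p c'l] /= cc'.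
have {}cc' : c = c'.
  apply: functional_extensionality_dep => X; apply/seteqP.
  by split=> S; rewrite cc'.
by rewrite -cc' in c'T c'p c'l *; congr Topology; apply: Prop_irrelevance.
Qed.

Lemma covers_closure J (X : C) (S : sieve X) : covers J S <-> closure J S = \top.
Proof.
rewrite -{1}[S]pull_sieve_id; split=> [cS|cST].
  rewrite -[closure J S]pull_sieve_id.
  exact/pull_sieve_topP.
by have : (closure J S) X (idc X) by rewrite cST.
Qed.

(** [closure J S] is the least saturated sieve above [S]; this is why [J] can be
    recovered from its saturated sieves alone. *)
Lemma covers_saturated J (X : C) (S : sieve X) :
  covers J S <-> forall T, saturated J T -> S <= T -> T = \top.
Proof.
rewrite covers_closure; split=> [cS T cT /(closure_le J)|]; last first.
  by apply; [apply: closureK|apply: closure_ge].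
by rewrite cS cT le1x => /eqP.
Qed.

Lemma closure_lex_reflectors J : lex_reflectors (saturated J) (closure J).
Proof.
split=> [X S|X S T cT|X S T|X|X Y f S].
- exact: closureK.
- apply/idP/idP; first exact: le_trans (closure_ge J S).
  by move=> /(closure_le J); rewrite cT.
- exact: closureI.
- by apply/eqP; rewrite -le1x; apply: closure_ge.
- by rewrite closure_pull.
Qed.

Section LexReflectors.
Variables (P : forall X : C, set (sieve X)).
Variables (j : forall X : C, sieve X -> sieve X).
Hypothesis Pj : lex_reflectors P j.

Lemma reflector_ge (X : C) (S : sieve X) : S <= j S.
Proof. by rewrite -(reflector_adj Pj) //; apply: (reflector_in Pj). Qed.

Lemma reflector_fix (X : C) (S : sieve X) : P S <-> j S = S.
Proof.
split=> [PS|<-]; last exact: reflector_in Pj _ _.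
by apply: le_anti; rewrite reflector_ge (reflector_adj Pj) ?lexx.
Qed.

Lemma lex_covers_pull (X Y : C) (f : hom Y X) (S : sieve X) :
  j S = \top -> j (pull_sieve f S) = \top.
Proof. by rewrite -(reflector_pull Pj) => ->; apply: pull_sieveT. Qed.

(** If [f^*(j R) = j (f^*R)] is the top sieve for all [f] in [B], then [B] lies
    below [j R], hence so does [j B]. *)
Lemma lex_covers_local (X : C) (B R : sieve X) :
  j B = \top ->
  (forall (Y : C) (f : hom Y X), B Y f -> j (pull_sieve f R) = \top) ->
  j R = \top.
Proof.
move=> jB jR; apply/eqP; rewrite -le1x -jB (reflector_adj Pj); last first.
  exact: reflector_in Pj _ _.
apply/sieve_leP => Y f /jR.
by rewrite -(reflector_pull Pj) => /pull_sieve_topP.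
Qed.

Definition lex_topology : topology C :=
  @Topology C (fun X => [set S | j S = \top]%classic) (reflectorT Pj)
    lex_covers_pull lex_covers_local.

(** Both sides hold of [f] exactly when [f^*(j S) = j (f^*S)] is top. *)
Lemma closure_lex_topology (X : C) (S : sieve X) : closure lex_topology S = j S.
Proof.
by apply: sieveP => Y f /=; rewrite -(reflector_pull Pj) pull_sieve_topP.
Qed.

Lemma saturated_lex_topology (X : C) (S : sieve X) :
  saturated lex_topology S <-> P S.
Proof. by rewrite reflector_fix /saturated /= closure_lex_topology. Qed.

End LexReflectors.

Lemma lex_reflectors_ext (P Q : forall X : C, set (sieve X)) j :
  (forall X (S : sieve X), P X S <-> Q X S) ->
  lex_reflectors P j -> lex_reflectors Q j.
Proof.
move=> PQ [jin jadj jI jT jpull]; split=> // [X S|X S T /PQ]; last exact: jadj.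
exact/PQ.
Qed.

End Topologies.

(** * Covering and saturation forms *)

Section Forms.
Variables (C : category) (F : form C).

Lemma covering_form_isoP (J : topology C) :
  form_iso F (covering_form J) <->
  fibrewise_injective (support F) /\
  (forall X (S : sieve X), support_image F S <-> covers J S).
Proof. exact: form_iso_subformP. Qed.

Lemma saturation_form_isoP (J : topology C) :
  form_iso F (saturation_form J) <->
  fibrewise_injective (support F) /\
  (forall X (S : sieve X), support_image F S <-> saturated J S).
Proof. exact: form_iso_subformP. Qed.

Lemma covering_form_iso_uniq (J J' : topology C) :
  form_iso F (covering_form J) -> form_iso F (covering_form J') -> J = J'.
Proof.
move=> /covering_form_isoP[_ FJ] /covering_form_isoP[_ FJ'].
by apply: topologyP => X S; rewrite -FJ -FJ'.
Qed.

Lemma saturation_form_iso_uniq (J J' : topology C) :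
  form_iso F (saturation_form J) -> form_iso F (saturation_form J') -> J = J'.
Proof.
move=> /saturation_form_isoP[_ FJ] /saturation_form_isoP[_ FJ'].
apply: topologyP => X S; rewrite !covers_saturated.
by split=> ST T; [rewrite -FJ' FJ|rewrite -FJ FJ']; apply: ST.
Qed.

Lemma covering_conditionP :
  (exists J, form_iso F (covering_form J)) <-> covering_condition F.
Proof.
split=> [[J /covering_form_isoP[F_inj FJ]]|[F_inj _ F_loc]].
  split=> // [X S T /FJ cS ST|X B R /FJ cB cR].
    by apply/FJ; apply: covers_up cS.
  by apply/FJ; apply: covers_local cB _ => Y f Bf; apply/FJ; apply: cR.
by exists (Topology (@support_imageT _ F) (@support_image_pull _ F) F_loc);
  apply/covering_form_isoP.
Qed.

Lemma saturation_form_lex (J : topology C) :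
  form_iso F (saturation_form J) ->
  lex_reflectors (support_image F) (closure J).
Proof.
move=> /saturation_form_isoP[_ FJ].
apply: lex_reflectors_ext (closure_lex_reflectors J) => X S.
by split=> /FJ.
Qed.

Lemma lex_saturation_form j (Fj : lex_reflectors (support_image F) j) :
  fibrewise_injective (support F) ->
  form_iso F (saturation_form (lex_topology Fj)).
Proof.
move=> F_inj; apply/saturation_form_isoP; split=> // X S.
by split=> /(saturated_lex_topology Fj).
Qed.

Lemma saturation_conditionP :
  (exists J, form_iso F (saturation_form J)) <-> saturation_condition F.
Proof.
split=> [[J FJ]|[F_inj _ [j Fj]]].
  have /saturation_form_isoP[F_inj _] := FJ.
  split=> //; first exact: support_image_pull.
  by exists (closure J); apply: saturation_form_lex.
by exists (lex_topology Fj); apply: lex_saturation_form.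
Qed.

End Forms.

(** * Their distributivity structures *)

Section DistributivityForms.
Variables (C : category) (D : distributivity_form C).

Lemma support_subform_sink (P : forall X : C, set (sieve X))
  (P_closed : subform_closed P) (X : C) (s : sink (subform P_closed) X) :
  map_sink (support (subform P_closed)) s = map_sink (subform_incl P_closed) s.
Proof.
congr Sink; apply: functional_extensionality_dep => i.
exact: support_subform.
Qed.

Lemma covering_distributivity_isoP (J : topology C) :
  distributivity_iso D (covering_distributivity J) <->
  form_iso D (covering_form J) /\
  (forall X (s : sink D X) (U : D X), admissible s U <->
     maximal_presentation (map_sink (support D) s) (support D X U)).
Proof.
apply: distributivity_isoP => X s U.
by rewrite support_subform_sink support_subform.
Qed.

Lemma saturation_distributivity_isoP (J : topology C) :
  distributivity_iso D (saturation_distributivity J) <->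
  form_iso D (saturation_form J) /\
  (forall X (s : sink D X) (U : D X), admissible s U <->
     support D X U = closure J (sink_union (map_sink (support D) s))).
Proof.
apply: (@distributivity_isoP _ _ (saturation_distributivity J)
  (fun X t V => V = closure J (sink_union t))) => X s U.
by rewrite support_subform_sink support_subform.
Qed.

(** The arrows of a sink have dependent types, so that equality of sinks is not
    componentwise; a fibrewise left inverse of [phi], applied to whole sinks,
    avoids comparing components. *)
Lemma map_sink_inj (F G : form C) (phi : form_hom F G) :
  fibrewise_injective phi -> forall X, injective (map_sink phi (X := X)).
Proof.
move=> phi_inj X.
have inv Y (B : G Y) : exists A, forall A', phi Y A' = B -> A = A'.
  have [[A AB]|nB] := pselect (exists A, phi Y A = B).
    by exists A => A' A'B; apply: phi_inj; rewrite AB.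
  by exists \top => A' A'B; case: nB; exists A'.
pose r Y B := sval (cid (inv Y B)).
have rK Y (A : F Y) : r Y (phi Y A) = A := svalP (cid (inv Y (phi Y A))) A erefl.
pose back (t : sink G X) : sink F X :=
  Sink (sink_idx t) (sink_dom t) (sink_arr t)
    (fun i => r (sink_dom t i) (sink_src t i)).
apply: (can_inj (g := back)) => -[I d a A]; congr Sink.
by apply: functional_extensionality_dep => i; apply: rK.
Qed.

Lemma support_sink_image (X : C) (t : sink (sieve_form C) X) :
  (forall i, support_image D (sink_src t i)) ->
  exists s : sink D X, map_sink (support D) s = t.
Proof.
case: t => I d a T /= T_im.
have T_ex i : exists A, support D (d i) A = T i by have [A _] := T_im i; exists A.
exists (Sink I d a (fun i => sval (cid (T_ex i)))); congr Sink.
by apply: functional_extensionality_dep => i; apply: svalP (cid (T_ex i)).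
Qed.

(** When the support is injective, a presentation in the image comes from just
    one presentation in [D], so that the comparison of images becomes a
    criterion for each presentation in [D]. *)
Lemma admissible_are_maximalP :
  fibrewise_injective (support D) ->
  admissible_are_maximal D <->
  (forall X (s : sink D X) (U : D X), admissible s U <->
     maximal_presentation (map_sink (support D) s) (support D X U)).
Proof.
move=> D_inj; split=> [DM X s U|DM X t V].
  have [to_max from_max] := DM X (map_sink (support D) s) (support D X U).
  split=> [sU|sU]; first by case: to_max => //; exists s, U.
  have [|s' [U' [sU' /(map_sink_inj D_inj)<- /D_inj<-]]] // := from_max.
  by split=> // [i|]; [exists (sink_src s i)|exists U].
split=> [[s [U [/DM sU <- <-]]]|[tV /support_sink_image[s sE] [U _ UV]]].
  by split=> // [i|]; [exists (sink_src s i)|exists U].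
by rewrite -sE -UV in tV *; exists s, U; split=> //; apply/DM.
Qed.

Lemma covering_distributivity_conditionP :
  (exists J, distributivity_iso D (covering_distributivity J)) <->
  covering_distributivity_condition D.
Proof.
split=> [[J /covering_distributivity_isoP[DJ DM]]|[D_cov DM]].
  have D_cov : covering_condition D by apply/covering_conditionP; exists J.
  by split=> //; apply/admissible_are_maximalP => //; case: D_cov.
have [D_inj _ _] := D_cov.
have /covering_conditionP[J DJ] := D_cov; exists J.
by apply/covering_distributivity_isoP; split=> //; apply/admissible_are_maximalP.
Qed.

(** Prescribing one admissible final lift of every sink prescribes all
    admissible presentations, because final lifts are unique. *)
Lemma admissible_everywhereP
    (c : forall X : C, sink (sieve_form C) X -> sieve X) :
  fibrewise_injective (support D) ->
  (forall X t, support_image D (c X t)) ->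
  (forall X (s : sink D X), exists2 U : D X,
     admissible s U & support D X U = c X (map_sink (support D) s)) <->
  (forall X (s : sink D X) (U : D X), admissible s U <->
     support D X U = c X (map_sink (support D) s)).
Proof.
move=> D_inj c_im; split=> [Dc X s U|Dc X s]; last first.
  by have [U _ UE] := c_im X (map_sink (support D) s); exists U => //; apply/Dc.
have [V sV VE] := Dc X s; rewrite -VE; split=> [sU|/D_inj->] //.
by congr (support D X _);
  apply: is_final_uniq (admissible_final sU) (admissible_final sV).
Qed.

Lemma saturation_distributivity_conditionP :
  (exists J, distributivity_iso D (saturation_distributivity J)) <->
  saturation_distributivity_condition D.
Proof.
split=> [[J /saturation_distributivity_isoP[DJ DM]]|[D_inj _ [j Dj DM]]].
  have /saturation_form_isoP[D_inj _] := DJ; have Dj := saturation_form_lex DJ.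
  split=> //; first exact: support_image_pull.
  exists (closure J) => //.
  apply/(admissible_everywhereP (c := fun X t => closure J (sink_union t))) => //.
  by move=> X t; apply: reflector_in Dj _ _.
exists (lex_topology Dj); apply/saturation_distributivity_isoP.
split=> [|X s U]; first exact: lex_saturation_form.
rewrite closure_lex_topology.
apply: (proj1 (admissible_everywhereP (c := fun X t => j X (sink_union t)) _ _)).
- exact: D_inj.
- by move=> Y t; apply: reflector_in Dj _ _.
- exact: DM.
Qed.

End DistributivityForms.

(** * Strength *)

Section Strength.
Variable C : category.

(** An arrow [k] with [h \oc k = sink_arr s i \oc g] and [g] in the [i]th source
    is [q i \oc w] for an arrow [w] with [p i \oc w = g]. *)
Lemma sink_union_pull (X Y : C) (h : hom Y X) (s : sink (sieve_form C) X)
    (P : sink_idx s -> C) (p : forall i, hom (P i) (sink_dom s i))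
    (q : forall i, hom (P i) Y) :
  (forall i, is_pullback (sink_arr s i) h (p i) (q i)) ->
  sink_union (pull_sink p q) = pull_sieve h (sink_union s).
Proof.
move=> pb; apply: sieveP => Z k; split.
  case=> i [w [sw ->]]; exists i, (p i \oc w); split=> //.
  by rewrite !Defs.compA (proj1 (pb i)).
case=> i [g [sg hk]]; have [_ /(_ _ g k)] := pb i.
case=> [|w [[pw qw] _]]; first by rewrite hk.
by exists i, w; rewrite qw; split=> //; rewrite /= pw.
Qed.

Lemma covering_strong (J : topology C) : strong (covering_distributivity J).
Proof.
move=> X Y h s U P p q pb sU.
pose t := map_sink (subform_incl (covers_closed J)) s.
have : pull_sieve h (subsieve_val U) = pull_sieve h (sink_union t).
  by congr pull_sieve.
by rewrite -(sink_union_pull (s := t) pb).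
Qed.

Lemma saturation_strong (J : topology C) : strong (saturation_distributivity J).
Proof.
move=> X Y h s U P p q pb sU.
pose t := map_sink (subform_incl (saturated_closed J)) s.
have : pull_sieve h (subsieve_val U) = pull_sieve h (closure J (sink_union t)).
  by congr pull_sieve.
by rewrite -closure_pull -(sink_union_pull (s := t) pb).
Qed.

End Strength.

(** * The characterizations *)

Lemma exists_unique_iff (T : Type) (P : T -> Prop) :
  (forall x y, P x -> P y -> x = y) -> (exists! x, P x) <-> (exists x, P x).
Proof.
move=> P_uniq; split=> [[x [Px _]]|[x Px]]; exists x => //.
by split=> // y; apply: P_uniq.
Qed.

Lemma distributivity_form_iso (C : category) (D E : distributivity_form C) :
  distributivity_iso D E -> form_iso D E.
Proof. by case=> phi [psi [pp _ _]]; exists phi, psi. Qed.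

Lemma unique_covering_form (C : category) (F : form C) :
  (exists! J : topology C, form_iso F (covering_form J)) <-> covering_condition F.
Proof.
rewrite exists_unique_iff; first exact: covering_conditionP.
exact: covering_form_iso_uniq.
Qed.

Lemma unique_saturation_form (C : category) (F : form C) :
  (exists! J : topology C, form_iso F (saturation_form J)) <->
  saturation_condition F.
Proof.
rewrite exists_unique_iff; first exact: saturation_conditionP.
exact: saturation_form_iso_uniq.
Qed.

Lemma unique_covering_distributivity (C : category) (D : distributivity_form C) :
  (exists! J : topology C, distributivity_iso D (covering_distributivity J)) <->
  covering_distributivity_condition D.
Proof.
rewrite exists_unique_iff; first exact: covering_distributivity_conditionP.
move=> J J' /distributivity_form_iso DJ /distributivity_form_iso DJ'.
exact: covering_form_iso_uniq DJ DJ'.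
Qed.

Lemma unique_saturation_distributivity (C : category)
    (D : distributivity_form C) :
  (exists! J : topology C, distributivity_iso D (saturation_distributivity J)) <->
  saturation_distributivity_condition D.
Proof.
rewrite exists_unique_iff; first exact: saturation_distributivity_conditionP.
move=> J J' /distributivity_form_iso DJ /distributivity_form_iso DJ'.
exact: saturation_form_iso_uniq DJ DJ'.
Qed.

Lemma unique_strong_iff (C : category) (D : distributivity_form C)
    (E : topology C -> distributivity_form C) (cond : Prop) :
  (forall J, strong (E J)) ->
  (exists! J, distributivity_iso D (E J)) <-> cond ->
  strong D /\ (exists! J, distributivity_iso D (E J)) <-> cond.
Proof.
move=> E_strong <-; split=> [[]//|DE]; split=> //.
by have [J [DJ _]] := DE; apply: distributivity_iso_strong DJ (E_strong J).
Qed.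

Theorem theorem1p9 (C : category) :
  [/\ (forall F : form C,
         (exists! J : topology C, form_iso F (covering_form J)) <->
         covering_condition F),
      (forall F : form C,
         (exists! J : topology C, form_iso F (saturation_form J)) <->
         saturation_condition F),
      (forall D : distributivity_form C,
         (exists! J : topology C,
            distributivity_iso D (covering_distributivity J)) <->
         covering_distributivity_condition D),
      (forall D : distributivity_form C,
         (exists! J : topology C,
            distributivity_iso D (saturation_distributivity J)) <->
         saturation_distributivity_condition D)
    & has_pullbacks C ->
      [/\ (forall J : topology C, strong (covering_distributivity J)),
          (forall J : topology C, strong (saturation_distributivity J)),
          (forall D : distributivity_form C,
             strong D /\
             (exists! J : topology C,
                distributivity_iso D (covering_distributivity J)) <->
             covering_distributivity_condition D)
        & (forall D : distributivity_form C,
             strong D /\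
             (exists! J : topology C,
                distributivity_iso D (saturation_distributivity J)) <->
             saturation_distributivity_condition D)]].
Proof.
split=> [F|F|D|D|_].
- exact: unique_covering_form.
- exact: unique_saturation_form.
- exact: unique_covering_distributivity.
- exact: unique_saturation_distributivity.
split=> [J|J|D|D].
- exact: covering_strong.
- exact: saturation_strong.
- apply: unique_strong_iff; first exact: covering_strong.
  exact: unique_covering_distributivity.
- apply: unique_strong_iff; first exact: saturation_strong.
  exact: unique_saturation_distributivity.
Qed.
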